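(* Let $Q$ be an inverse quantal frame. Every complete Hilbert $Q$-module is a $Q$-sheaf; that is, if $X$ is a complete Hilbert $Q$-module, then the underlying sup-lattice of $X$ is a frame and the locale it defines, with the given action of $Q$, is a $Q$-sheaf.
   Context: An involutive quantale is a sup-lattice (complete lattice) $Q$ with an associative multiplication preserving arbitrary joins in each variable and a join-preserving involution $a\mapsto a^*$ with $a^{**}=a$, $(ab)^*=b^*a^*$; it is unital if the multiplication has a unit $e$. $1$ denotes a top element. A left $Q$-module (for $Q$ unital) is a sup-lattice $X$ with an associative, unital action $Q\times X\to X$ preserving joins in each variable; homomorphisms preserve joins and the action. Inverse quantal frames: a support on a unital involutive quantale $Q$ is a join-preserving map $\varsigma:Q\to Q$ with $\varsigma(a)\le e$, $\varsigma(a)\le aa^*$ and $a\le\varsigma(a)a$ for all $a$; it is stable if $\varsigma(ab)=\varsigma(a\varsigma(b))$ for all $a,b$. A stable quantal frame is a unital involutive quantale with a stable support whose underlying lattice is a frame. An inverse quantal frame is a stable quantal frame $Q$ with $\bigvee\{s\in Q\mid ss^*\vee s^*s\le e\}=1$. The base locale of $Q$ is $B=\{b\in Q\mid b\le e\}$, a frame which is a unital subquantale of $Q$ with trivial involution and multiplication $bc=b\wedge c$. Complete Hilbert modules: a pre-Hilbert $Q$-module is a left $Q$-module $X$ with an inner product $\langle-,-\rangle:X\times X\to Q$ satisfying $\langle ax,y\rangle=a\langle x,y\rangle$, $\langle\bigvee_i x_i,y\rangle=\bigvee_i\langle x_i,y\rangle$ and $\langle x,y\rangle=\langle y,x\rangle^*$;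 it is a Hilbert $Q$-module if moreover $\langle x,-\rangle=\langle y,-\rangle$ implies $x=y$. A Hilbert section is an element $s\in X$ such that $\langle x,s\rangle s\le x$ for all $x\in X$; a Hilbert module $X$ is complete if, for all $x\in X$, $x$ is the join of the elements $\langle x,s\rangle s$ with $s$ ranging over all the Hilbert sections. $Q$-sheaves: for a locale $X$, $\mathcal O(X)$ denotes the corresponding frame. A $Q$-locale is a locale $X$ with a left $Q$-module structure on $\mathcal O(X)$ such that $bx=b1\wedge x$ for all $b\in B$, $x\in\mathcal O(X)$. It is open if there is a (necessarily unique) homomorphism of $B$-modules $\varsigma:\mathcal O(X)\to B$ with $\varsigma(x)x=x$ for all $x$. A local section of an open $Q$-locale is an element $s\in\mathcal O(X)$ such that $x=\varsigma(x)s$ for all $x\le s$. A $Q$-sheaf is an open $Q$-locale $X$ such that the join of all the local sections is $1$. *)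

(* Defs.v *)
From HB Require Import structures.
From mathcomp Require Import all_boot all_order.
From mathcomp Require Import boolp classical_sets.

Set Implicit Arguments.
Unset Strict Implicit.
Unset Printing Implicit Defensive.

Import Order.TTheory.

(* Meets, binary joins, [\top] and [\bot] are those of MathComp's bounded
   lattices: they are determined by the order, so a complete lattice is exactly
   a bounded lattice in which every set has a supremum. *)
HB.mixin Record hasLub (d : Order.disp_t) T of Order.TBLattice d T := {
  lub : set T -> T;
  lubP : forall A : set T, supremums A (lub A)
}.

#[short(type="supLatticeType")]
HB.structure Definition SupLattice (d : Order.disp_t) :=
  { T of hasLub d T & Order.TBLattice d T }.

Arguments lub {d s} A.

(* [A] may be empty, so such an [f] preserves [\bot]. *)
Definition join_preserving (d d' : Order.disp_t) (T : supLatticeType d)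
    (T' : supLatticeType d') (f : T -> T') : Prop :=
  forall A : set T, f (lub A) = lub (f @` A)%classic.

Definition frame (d : Order.disp_t) (T : supLatticeType d) : Prop :=
  forall x : T, join_preserving (Order.meet x).

(* The multiplication, the unit and the involution are those of a *-monoid.
   MathComp writes the involution of a *-monoid [a^-1]; it need not be an
   inverse, and is denoted by [a^*] below.  The unit is [1%g], and the top
   element (often written 1 in the theory of quantales) is [\top]. *)
HB.mixin Record isUnitalInvQuantale (d : Order.disp_t) Q
    of SupLattice d Q & StarMonoid Q := {
  mulq_lubl : forall b : Q, join_preserving (fun a : Q => (a * b)%g);
  mulq_lubr : forall a : Q, join_preserving (fun b : Q => (a * b)%g);
  invq_lub : join_preserving (fun a : Q => (a^-1)%g)
}.

#[short(type="uiQuantaleType")]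
HB.structure Definition UnitalInvQuantale (d : Order.disp_t) :=
  { Q of isUnitalInvQuantale d Q & SupLattice d Q & StarMonoid Q }.

Definition star (d : Order.disp_t) (Q : uiQuantaleType d) (a : Q) : Q :=
  (a^-1)%g.

Notation "a ^*" := (star a) : group_scope.

Local Open Scope group_scope.
Local Open Scope order_scope.

Section InverseQuantalFrames.
Variables (d : Order.disp_t) (Q : uiQuantaleType d).
Implicit Types (a b s : Q) (supp : Q -> Q).

Definition is_support supp : Prop :=
  [/\ join_preserving supp,
      forall a, supp a <= 1,
      forall a, supp a <= a * a^*
    & forall a, a <= supp a * a].

Definition stable supp : Prop :=
  forall a b, supp (a * b) = supp (a * supp b).

(* A stable support is unique when it exists, so its mere existence is
   required instead of making it part of the structure. *)
Definition stable_quantal_frame : Prop :=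
  frame Q /\ exists supp, is_support supp /\ stable supp.

Definition inverse_quantal_frame : Prop :=
  stable_quantal_frame /\
  lub [set s : Q | (s * s^* `|` s^* * s <= 1)%O]%classic = \top.

(* The base locale, whose order, joins and multiplication are those of [Q]. *)
Definition base : set Q := [set b : Q | b <= 1]%classic.

End InverseQuantalFrames.

Arguments inverse_quantal_frame {d} Q.
Arguments base {d} Q.

HB.mixin Record isQModule (dQ : Order.disp_t) (Q : uiQuantaleType dQ)
    (d : Order.disp_t) X of SupLattice d X := {
  act : Q -> X -> X;
  actM : forall (a b : Q) (x : X), act (a * b) x = act a (act b x);
  act1 : forall x : X, act 1 x = x;
  act_lubl : forall x : X, join_preserving (fun a : Q => act a x);
  act_lubr : forall a : Q, join_preserving (act a)
}.

#[short(type="qModuleType")]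
HB.structure Definition QModule (dQ : Order.disp_t) (Q : uiQuantaleType dQ)
    (d : Order.disp_t) :=
  { X of isQModule dQ Q d X & SupLattice d X }.

Notation "a '•' x" := (act a x)
  (at level 40, left associativity, format "a  '•'  x") : order_scope.

HB.mixin Record isPreHilbert (dQ : Order.disp_t) (Q : uiQuantaleType dQ)
    (d : Order.disp_t) X of QModule dQ Q d X := {
  inner : X -> X -> Q;
  innerZl : forall (a : Q) (x y : X), inner (a • x) y = a * inner x y;
  inner_lubl : forall y : X, join_preserving (fun x : X => inner x y);
  innerC : forall x y : X, inner x y = (inner y x)^*
}.

#[short(type="preHilbertModuleType")]
HB.structure Definition PreHilbertModule (dQ : Order.disp_t)
    (Q : uiQuantaleType dQ) (d : Order.disp_t) :=
  { X of isPreHilbert dQ Q d X & QModule dQ Q d X }.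

HB.mixin Record isHilbert (dQ : Order.disp_t) (Q : uiQuantaleType dQ)
    (d : Order.disp_t) X of PreHilbertModule dQ Q d X := {
  inner_inj : forall x y : X, inner x = inner y :> (X -> Q) -> x = y
}.

#[short(type="hilbertModuleType")]
HB.structure Definition HilbertModule (dQ : Order.disp_t)
    (Q : uiQuantaleType dQ) (d : Order.disp_t) :=
  { X of isHilbert dQ Q d X & PreHilbertModule dQ Q d X }.

Section CompleteHilbertModules.
Variables (dQ : Order.disp_t) (Q : uiQuantaleType dQ).
Variables (d : Order.disp_t) (X : hilbertModuleType Q d).

Definition hilbert_section (s : X) : Prop :=
  forall x : X, inner x s • s <= x.

Definition complete_hilbert : Prop :=
  forall x : X,
    x = lub [set inner x s • s | s in [set s : X | hilbert_section s]]%classic.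

End CompleteHilbertModules.

Arguments complete_hilbert {dQ Q d} X.

Section QSheaves.
Variables (dQ : Order.disp_t) (Q : uiQuantaleType dQ).
Variables (d : Order.disp_t) (X : qModuleType Q d).
Implicit Types (x s : X) (supp : X -> Q).

(* [X] plays the role of the frame O(X) of the locale. *)
Definition Q_locale : Prop :=
  frame X /\ forall b x, base Q b -> b • x = (b • \top) `&` x.

(* [supp] is a homomorphism of [base Q]-modules from [X] to [base Q] such that
   [supp x • x = x]; it is unique when it exists. *)
Definition open_support supp : Prop :=
  [/\ forall x, base Q (supp x),
      join_preserving supp,
      forall b x, base Q b -> supp (b • x) = b * supp x
    & forall x, supp x • x = x].

(* An open Q-locale, together with its support. *)
Definition open_Q_locale supp : Prop := Q_locale /\ open_support supp.

Definition local_section supp s : Prop :=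
  forall x, x <= s -> x = supp x • s.

Definition Q_sheaf : Prop :=
  exists2 supp, open_Q_locale supp &
    lub [set s : X | local_section supp s]%classic = \top.

End QSheaves.

Arguments Q_sheaf {dQ Q d} X.

(* Main.v *)
Require Import Defs.
From mathcomp Require Import all_boot all_order.
From mathcomp Require Import boolp classical_sets.

(** Two facts carry the proof.

    Partial units translate sections: if [s] is a Hilbert section and
    [u^* * u <= 1], then [u • s] is again a Hilbert section.  Since [Q] is a
    frame covered by its partial units, every coefficient [inner x s] is a join
    of partial units, so completeness upgrades to density: each [x] is the join
    of the Hilbert sections below it ([section_dense]).

    The support [supp] of [Q] transfers to [X] by
    [module_support x = \/_s supp (inner x s)].  Completeness gives
    [module_support x • x = x], stability makes it equivariant for the base, and
    [supp a <= a * a^*] gives [module_support x <= inner x x], because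
    [inner x s * inner s x = inner (inner x s • s) x] and [s] is a section.
    This last inequality turns information about [x] into information about
    inner products: for [x <= s] it yields
    [module_support x • s <= inner x s • s <= x], so every Hilbert section [s]
    is a local section, and density then says that local sections cover [X].

    The lattice [X] inherits the frame law from that of [Q].  If a section [t]
    is below [\/ A], then
    [module_support t <= 1 `&` inner t (\/ A) = \/_(y in A) (1 `&` inner t y)].
    Each [b = 1 `&` inner t y] is self-adjoint, so
    [b • t <= inner y t • t <= y], and hence
    [t = module_support t • t] is covered by the elements [t `&` y]
    ([section_covered]).  Density extends this from sections to all of [X]. *)

Set Implicit Arguments.
Unset Strict Implicit.
Unset Printing Implicit Defensive.

Import Order.TTheory.

Local Open Scope group_scope.
Local Open Scope order_scope.

(** * Sup-lattices and join-preserving maps *)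

Section SupLattices.
Context {d : Order.disp_t} {T : supLatticeType d}.
Implicit Types (x y : T) (A B : set T).

Lemma lub_ub A x : A x -> x <= lub A.
Proof. by have [ubA _] := lubP A => Ax; exact: ubA. Qed.

Lemma lub_le A y : (forall x, A x -> x <= y) -> lub A <= y.
Proof. by have [_ leA] := lubP A => Ay; apply: leA => x /Ay. Qed.

Lemma lub_mono A B : (A `<=` B)%classic -> lub A <= lub B.
Proof. by move=> AB; apply: lub_le => x /AB; exact: lub_ub. Qed.

Lemma lub_pair x y : x <= y -> lub [set x; y]%classic = y.
Proof.
move=> xy; apply/le_anti/andP; split.
  by apply: lub_le => z [->|->].
by apply: lub_ub; right.
Qed.

End SupLattices.

Section JoinPreservingMaps.
Context {d : Order.disp_t} {T : supLatticeType d}.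
Context {d' : Order.disp_t} {T' : supLatticeType d'} {f : T -> T'}.
Hypothesis f_join : join_preserving f.
Implicit Types (x y : T) (A : set T).

Lemma join_preserving_mono x y : x <= y -> f x <= f y.
Proof.
by move=> xy; rewrite -(lub_pair xy) f_join; apply: lub_ub; exists x => //; left.
Qed.

Lemma join_preserving_lub_le A z :
  (forall x, A x -> f x <= z) -> f (lub A) <= z.
Proof. by move=> Az; rewrite f_join; apply: lub_le => _ [x /Az ? <-]. Qed.

End JoinPreservingMaps.

(** * Partial units and supports in a quantale *)

Section Quantales.
Context {dQ : Order.disp_t} {Q : uiQuantaleType dQ}.
Implicit Types a b c u : Q.

Lemma mulq_mono a a' b b' : a <= a' -> b <= b' -> a * b <= a' * b'.
Proof.
move=> aa' bb'; apply: (le_trans (y := a' * b)).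
  exact: (join_preserving_mono (mulq_lubl b)).
exact: (join_preserving_mono (mulq_lubr a')).
Qed.

Lemma starK a : a^*^* = a. Proof. exact: invgK. Qed.

Lemma starM a b : (a * b)^* = b^* * a^*. Proof. exact: invgM. Qed.

Lemma star_lub : join_preserving (star (Q := Q)). Proof. exact: invq_lub. Qed.

Lemma star_mono a b : a <= b -> a^* <= b^*.
Proof. exact: (join_preserving_mono star_lub). Qed.

Lemma star_base b : b <= 1 -> b^* <= 1.
Proof. by move=> /star_mono; rewrite {2}/star invg1. Qed.

Definition partial_unit : set Q :=
  [set u : Q | (u * u^* `|` u^* * u <= 1)%O]%classic.

Lemma partial_unit_le a u : a <= u -> partial_unit u -> partial_unit a.
Proof.
rewrite /partial_unit /= !leUx => au /andP[uu1 uu2].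
by rewrite (le_trans _ uu1) ?(le_trans _ uu2) //;
  apply: mulq_mono => //; exact: star_mono.
Qed.

Section Supports.
Context {supp : Q -> Q}.
Hypothesis supp_support : is_support supp.

(** Multiplying by an element below the unit decreases, so both axioms
    [supp b <= b * b^*] and [b <= supp b * b] collapse. *)
Lemma support_base b : b <= 1 -> supp b = b.
Proof.
have [_ s1 sM sl] := supp_support => b1; apply/le_anti/andP; split.
  by rewrite (le_trans (sM b))// -[leRHS]mulg1 mulq_mono// star_base.
by rewrite (le_trans (sl b))// -[leRHS]mulg1 mulq_mono.
Qed.

(** For [c <= 1], [c = supp c <= c * c^* <= c^*]; this applies to both [b] and
    [b^*]. *)
Lemma base_self_adjoint b : b <= 1 -> b^* = b.
Proof.
have [_ _ sM _] := supp_support.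
have half c : c <= 1 -> c <= c^*.
  move=> c1; have := sM c; rewrite support_base// => /le_trans; apply.
  by rewrite -[leRHS]mul1g mulq_mono.
move=> b1; apply/le_anti; rewrite half// andbT.
by have := half _ (star_base b1); rewrite starK.
Qed.

(** Stability moves [supp] onto [a], and [b * supp a] already lies below the
    unit, where [supp] is the identity. *)
Lemma support_baseM b a : stable supp -> b <= 1 -> supp (b * a) = b * supp a.
Proof.
have [_ s1 _ _] := supp_support => st b1; rewrite st support_base//.
by rewrite -[leRHS]mulg1 mulq_mono.
Qed.

End Supports.
End Quantales.

Arguments partial_unit {dQ} Q.

(** * Modules and Hilbert sections *)

Section Modules.
Context {dQ : Order.disp_t} {Q : uiQuantaleType dQ}.
Context {d : Order.disp_t} {X : qModuleType Q d}.
Implicit Types (a b : Q) (x y : X).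

Lemma act_mono a b x y : a <= b -> x <= y -> a • x <= b • y.
Proof.
move=> ab xy; apply: (le_trans (y := b • x)).
  exact: (join_preserving_mono (act_lubl x)).
exact: (join_preserving_mono (act_lubr b)).
Qed.

Lemma act_base_le b x : b <= 1 -> b • x <= x.
Proof. by move=> b1; rewrite -[leRHS]act1 act_mono. Qed.

End Modules.

Section HilbertModules.
Context {dQ : Order.disp_t} {Q : uiQuantaleType dQ}.
Context {d : Order.disp_t} {X : hilbertModuleType Q d}.
Implicit Types (a b u : Q) (x y s t : X).

Lemma inner_lubr x : join_preserving (inner x : X -> Q).
Proof.
move=> A; rewrite innerC inner_lubl star_lub image_comp.
by congr lub; apply: eq_imagel => y _ /=; rewrite [RHS]innerC.
Qed.

Lemma innerZr x a y : inner x (a • y) = inner x y * a^*.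
Proof. by rewrite innerC innerZl starM -innerC. Qed.

Lemma inner_mono x x' y y' : x <= x' -> y <= y' -> inner x y <= inner x' y'.
Proof.
move=> xx' yy'; apply: (le_trans (y := inner x' y)).
  exact: (join_preserving_mono (inner_lubl y)).
exact: (join_preserving_mono (inner_lubr x')).
Qed.

(** [inner x (u • s) • (u • s) = inner x s • ((u^* * u) • s)], and
    [u^* * u <= 1]. *)
Lemma partial_unit_section u s :
  partial_unit Q u -> hilbert_section s -> hilbert_section (u • s).
Proof.
rewrite /partial_unit /= leUx => /andP[_ uu] hs x.
rewrite innerZr -actM -mulgA actM; apply: le_trans (hs x).
by rewrite act_mono// act_base_le.
Qed.

(** * Complete Hilbert modules: density, support, local sections, frame law *)

Section Complete.
Hypothesis X_complete : complete_hilbert X.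

(** In the join of the [inner x s • s], each coefficient is the join of the
    partial units [inner x s `&` u], and these carry [s] to sections below
    [x]. *)
Lemma section_dense x : frame Q -> lub (partial_unit Q) = \top ->
  x = lub [set t : X | hilbert_section t /\ t <= x]%classic.
Proof.
move=> fQ units_cover; apply/le_anti/andP; split; last by apply: lub_le => t [].
rewrite {1}[x in x <= _]X_complete; apply: lub_le => _ [s hs <-].
rewrite -[inner x s]meetx1 -units_cover fQ.
apply: (join_preserving_lub_le (act_lubl s)) => _ [u pu <-].
apply: lub_ub; split.
  by apply: partial_unit_section => //; apply: partial_unit_le pu; exact: leIr.
by apply: le_trans (hs x); rewrite act_mono// leIl.
Qed.

Section ModuleSupport.
Context {supp : Q -> Q}.
Hypothesis supp_support : is_support supp.

Definition module_support x : Q :=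
  lub [set supp (inner x s) | s in [set s : X | hilbert_section s]]%classic.

Lemma module_support_base x : module_support x <= 1.
Proof.
by have [_ s1 _ _] := supp_support; apply: lub_le => _ [s _ <-].
Qed.

Lemma module_support_join : join_preserving module_support.
Proof.
have [sj _ _ _] := supp_support => A; apply/le_anti/andP; split.
  apply: lub_le => _ [s hs <-]; rewrite inner_lubl.
  apply: (join_preserving_lub_le sj) => _ [x Ax <-].
  apply: (le_trans (y := module_support x)); apply: lub_ub.
    by exists s.
  by exists x.
apply: lub_le => _ [x Ax <-]; apply: lub_le => _ [s hs <-].
apply: (le_trans (y := supp (inner (lub A) s))); last by apply: lub_ub; exists s.
by apply: (join_preserving_mono sj); apply: inner_mono => //; exact: lub_ub.
Qed.

Lemma module_supportZ b x :
  stable supp -> b <= 1 -> module_support (b • x) = b * module_support x.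
Proof.
move=> st b1; rewrite /module_support mulq_lubr image_comp.
congr lub; apply: eq_imagel => s _ /=.
by rewrite innerZl (support_baseM supp_support).
Qed.

Lemma module_support_act x : module_support x • x = x.
Proof.
have [_ _ _ sl] := supp_support; apply/le_anti/andP; split.
  exact/act_base_le/module_support_base.
rewrite {1}[x in x <= _]X_complete; apply: lub_le => _ [s hs <-].
apply: (le_trans (y := (supp (inner x s) * inner x s) • s)).
  by rewrite act_mono.
by rewrite actM act_mono//; apply: lub_ub; exists s.
Qed.

(** [supp (inner x s) <= inner x s * inner s x = inner (inner x s • s) x], and
    [inner x s • s <= x] because [s] is a section. *)
Lemma module_support_inner x : module_support x <= inner x x.
Proof.
have [_ _ sM _] := supp_support; apply: lub_le => _ [s hs <-].
apply: le_trans (sM _) _; rewrite -innerC -innerZl.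
exact: inner_mono.
Qed.

(** An element [y] below [b • \top] has support below [b], hence
    [y = module_support y • y <= b • y]. *)
Lemma base_act_meet b x :
  stable supp -> b <= 1 -> b • x = (b • \top) `&` x.
Proof.
move=> st b1; apply/le_anti/andP; split.
  by rewrite lexI act_mono ?lex1//= act_base_le.
set y := _ `&` x; rewrite -(module_support_act y).
apply: act_mono; last exact: leIr.
apply: (le_trans (y := module_support (b • \top))).
  exact: (join_preserving_mono module_support_join (leIl _ _)).
by rewrite module_supportZ// -[leRHS]mulg1 mulq_mono// module_support_base.
Qed.

(** For [x <= s], [module_support x <= inner x x <= inner x s], so
    [module_support x • s] is below [inner x s • s <= x]. *)
Lemma hilbert_local_section s :
  hilbert_section s -> local_section module_support s.
Proof.
move=> hs x xs; apply/le_anti/andP; split.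
  by rewrite -{1}(module_support_act x) act_mono.
apply: le_trans (hs x); rewrite act_mono//.
by apply: le_trans (module_support_inner x) _; rewrite inner_mono.
Qed.

(** The frame law of [X] for a section: the support of [t] lies below the unit
    and below the join of the [inner t y], so the frame law of [Q] splits it
    into the pieces [1 `&` inner t y], each of which carries [t] below [y]. *)
Lemma section_covered t (A : set X) : frame Q -> hilbert_section t ->
  t <= lub A -> t <= lub [set (t `&` y)%O | y in A]%classic.
Proof.
move=> fQ ht tA.
have supp_le : module_support t <= 1 `&` lub (inner t @` A)%classic.
  rewrite lexI module_support_base -inner_lubr.
  by apply: le_trans (module_support_inner t) _; rewrite inner_mono.
rewrite -{1}(module_support_act t).
apply: le_trans (act_mono supp_le (lexx t)) _; rewrite fQ.
apply: (join_preserving_lub_le (act_lubl t)) => _ [_ [y Ay <-] <-].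
apply: (le_trans (y := t `&` y)); last by apply: lub_ub; exists y.
rewrite lexI act_base_le ?leIl//=.
apply: le_trans (ht y); rewrite act_mono//.
(* [1 `&` inner t y] equals its adjoint, which is below [inner y t]. *)
rewrite -(base_self_adjoint supp_support (leIl _ _)) [leRHS]innerC.
exact/star_mono/leIr.
Qed.

Lemma complete_hilbert_frame :
  frame Q -> lub (partial_unit Q) = \top -> frame X.
Proof.
move=> fQ units_cover x A; apply/le_anti/andP; split; last first.
  apply: lub_le => _ [y Ay <-]; rewrite lexI leIl/=.
  by apply: le_trans (leIr _ _) _; exact: lub_ub.
rewrite [leLHS]section_dense//; apply: lub_le => t [ht].
rewrite lexI => /andP[tx /(section_covered fQ ht)] /le_trans; apply.
apply: lub_le => _ [y Ay <-]; apply: (le_trans (y := x `&` y)).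
  exact: leI2.
by apply: lub_ub; exists y.
Qed.

End ModuleSupport.
End Complete.
End HilbertModules.

Arguments module_support {dQ Q d X} supp x.

Theorem theorem4p47 (dQ : Order.disp_t) (Q : uiQuantaleType dQ)
    (d : Order.disp_t) (X : hilbertModuleType Q d) :
  inverse_quantal_frame Q -> complete_hilbert X -> Q_sheaf X.
Proof.
move=> [[fQ [supp [supp_support st]]] units_cover] X_complete.
exists (module_support supp).
  split; first split.
  - exact: (complete_hilbert_frame X_complete supp_support).
  - by move=> b x; exact: (base_act_meet X_complete supp_support).
  split.
  - exact: (module_support_base supp_support).
  - exact: (module_support_join supp_support).
  - by move=> b x; exact: (module_supportZ supp_support).
  - exact: (module_support_act X_complete supp_support).
apply/le_anti; rewrite lex1 /= [leLHS](section_dense X_complete)//.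
apply: lub_mono => s [hs _].
exact: (hilbert_local_section X_complete supp_support).
Qed.
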